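(* Let $e\ne0,m,\zeta,\mu_1,\mu_2,J$ be real constants and $a>0$. On $\mathbb R^3$ with coordinates $(q^1,q^2,q^3)$ consider the metric $ds^2=-e^{2aq^3}[(dq^1)^2+(dq^2)^2]+a^2(dq^3)^2$ (a chart of 3-dimensional de Sitter space), the potential $$\mathscr{A}=e^{aq^3}\bigl[\mu_1(q^1\cos q^3+q^2\sin q^3)+\mu_2(q^1\sin q^3-q^2\cos q^3)\bigr]dq^3,$$ and the Klein--Gordon operator $\hat H$. Let $$\hat X_1=\partial_{q^1}-\frac{ie\,e^{aq^3}}{1+a^2}\bigl[(a\mu_1-\mu_2)\cos q^3+(\mu_1+a\mu_2)\sin q^3\bigr],$$ $$\hat X_2=\partial_{q^2}+\frac{ie\,e^{aq^3}}{1+a^2}\bigl[(\mu_1+a\mu_2)\cos q^3-(a\mu_1-\mu_2)\sin q^3\bigr],$$ $$\hat X_3=-(aq^1+q^2)\partial_{q^1}+(q^1-aq^2)\partial_{q^2}+\partial_{q^3},$$ $$\hat\ell_1=iJe^{a\lambda}\cos\lambda,\quad \hat\ell_2=iJe^{a\lambda}\sin\lambda,\quad \hat\ell_3=\partial_\lambda,\qquad\lambda\in\mathbb R.$$ Then: (a) the smooth solutions $\varphi(q,\lambda)$ on $\mathbb R^3\times\mathbb R$ of the system $\hat X_A\varphi=-\hat\ell_A\varphi$, $A=1,2,3$, are exactly $$\varphi_J=\Phi_J(v)\exp\bigl[ie\,S(q)-iJe^{a\lambda}(q^1\cos\lambda+q^2\sin\lambda)\bigr],\qquad v=q^3-\lambda,$$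 $$S(q)=\frac{e^{aq^3}}{1+a^2}\Bigl[\bigl((a\mu_1-\mu_2)q^1-(\mu_1+a\mu_2)q^2\bigr)\cos q^3+\bigl((\mu_1+a\mu_2)q^1+(a\mu_1-\mu_2)q^2\bigr)\sin q^3\Bigr],$$ with $\Phi_J$ an arbitrary smooth function on $\mathbb R$; (b) such a $\varphi_J$ satisfies $\hat H\varphi_J=0$ if and only if $$\Phi_J''+2a\Phi_J'+\Bigl[-\frac{2ea^2Je^{-av}}{1+a^2}\bigl((a\mu_1-\mu_2)\cos v+(\mu_1+a\mu_2)\sin v\bigr)+a^2J^2e^{-2av}+a^2(m^2+6\zeta)+\frac{e^2a^2(\mu_1^2+\mu_2^2)}{1+a^2}\Bigr]\Phi_J=0 .$$
   Context: For a metric $g$ and potential $\mathscr{A}$ on a coordinate domain, $\hat H\varphi=|g|^{-1/2}(\partial_a-ie\mathscr{A}_a)\bigl(|g|^{1/2}g^{ab}(\partial_b-ie\mathscr{A}_b)\varphi\bigr)+(6\zeta+m^2)\varphi$, i.e. $\hat H=g^{ab}D_aD_b+\zeta R+m^2$ with $R=6$. In this formula the index letters $a,b$ are coordinate indices, not the parameter $a$. Differential operators in $q$ and in $\lambda$ act on functions $\varphi(q,\lambda)$. *)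

(* Defs.v *)
From mathcomp Require Import all_boot all_order all_algebra.
From mathcomp Require Import complex.
From mathcomp Require Import all_classical all_reals all_analysis.

Set Implicit Arguments.
Unset Strict Implicit.
Unset Printing Implicit Defensive.

Import Order.TTheory GRing.Theory Num.Theory.
Import numFieldNormedType.Exports.

Local Open Scope ring_scope.
Local Open Scope complex_scope.
Local Open Scope classical_set_scope.

Definition cexp (R : realType) (z : R[i]) : R[i] :=
  (expR (complex.Re z))%:C
    * (cos (complex.Im z) +i* sin (complex.Im z)).

(* R[i] carries no normed R-module structure, so complex-valued functions are
   differentiated along real directions componentwise. *)
Definition cderive (R : realType) (V : normedModType R) (v : V)
    (f : V -> R[i]) (x : V) : R[i] :=
  'D_v (fun y => complex.Re (f y)) x +i* 'D_v (fun y => complex.Im (f y)) x.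

Definition iter_derive (R : realType) (V : normedModType R) (vs : seq V)
    (f : V -> R) : V -> R :=
  foldr (fun v h => 'D_v h) f vs.

(* On a finite-dimensional V (the only use made of it) this is C^oo: the
   iterated directional derivatives of all orders exist and are continuous. *)
Definition rsmooth (R : realType) (V : normedModType R) (f : V -> R) : Prop :=
  forall vs : seq V,
    continuous (iter_derive vs f)
    /\ forall (v x : V), derivable (iter_derive vs f) x v.

Definition smooth (R : realType) (V : normedModType R) (f : V -> R[i]) : Prop :=
  rsmooth (fun x => complex.Re (f x)) /\ rsmooth (fun x => complex.Im (f x)).

(* The coordinates (q^1, q^2, q^3) of q are q 0 0, q 0 1, q 0 2. *)
Definition x1 (R : realType) (q : 'rV[R]_3) : R := q 0 0.
Definition x2 (R : realType) (q : 'rV[R]_3) : R := q 0 1.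
Definition x3 (R : realType) (q : 'rV[R]_3) : R := q 0 2.

Definition partial (R : realType) (b : 'I_3) (f : 'rV[R]_3 -> R[i]) :
    'rV[R]_3 -> R[i] :=
  cderive (delta_mx 0 b) f.

Definition covariant (R : realType) (e : R) (A : 'rV[R]_3 -> 'rV[R]_3)
    (b : 'I_3) (f : 'rV[R]_3 -> R[i]) (q : 'rV[R]_3) : R[i] :=
  partial b f q - 'i * (e * A q 0 b)%:C * f q.

(* [g q] is the matrix (g_ab) at q, so that (g^ab) is [invmx (g q)], and
   |g| is the absolute value of the determinant. The scalar curvature of [metric]
   below is 6, whence the term 6 * zeta. *)
Definition klein_gordon (R : realType) (g : 'rV[R]_3 -> 'M[R]_3)
    (A : 'rV[R]_3 -> 'rV[R]_3) (e m zeta : R)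
    (f : 'rV[R]_3 -> R[i]) (q : 'rV[R]_3) : R[i] :=
  ((Num.sqrt `|\det (g q)|)^-1)%:C
    * (\sum_(b < 3) covariant e A b
         (fun p => \sum_(c < 3)
            (Num.sqrt `|\det (g p)| * invmx (g p) b c)%:C
              * covariant e A c f p) q)
  + (6 * zeta + m ^+ 2)%:C * f q.

Definition metric (R : realType) (a : R) (q : 'rV[R]_3) : 'M[R]_3 :=
  diag_mx (\row_(b < 3)
    (if b == 2 then a ^+ 2 else - expR (2 * a * x3 q))).

Definition potential (R : realType) (a mu1 mu2 : R) (q : 'rV[R]_3) :
    'rV[R]_3 :=
  (expR (a * x3 q)
    * (mu1 * (x1 q * cos (x3 q) + x2 q * sin (x3 q))
       + mu2 * (x1 q * sin (x3 q) - x2 q * cos (x3 q)))) *: delta_mx 0 2.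

Definition X1 (R : realType) (a e mu1 mu2 : R) (f : 'rV[R]_3 -> R[i])
    (q : 'rV[R]_3) : R[i] :=
  partial 0 f q
  - 'i * (e * expR (a * x3 q) / (1 + a ^+ 2)
          * ((a * mu1 - mu2) * cos (x3 q)
             + (mu1 + a * mu2) * sin (x3 q)))%:C * f q.

Definition X2 (R : realType) (a e mu1 mu2 : R) (f : 'rV[R]_3 -> R[i])
    (q : 'rV[R]_3) : R[i] :=
  partial 1 f q
  + 'i * (e * expR (a * x3 q) / (1 + a ^+ 2)
          * ((mu1 + a * mu2) * cos (x3 q)
             - (a * mu1 - mu2) * sin (x3 q)))%:C * f q.

Definition X3 (R : realType) (a : R) (f : 'rV[R]_3 -> R[i])
    (q : 'rV[R]_3) : R[i] :=
  - (a * x1 q + x2 q)%:C * partial 0 f q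
  + (x1 q - a * x2 q)%:C * partial 1 f q
  + partial 2 f q.

Definition ell1 (R : realType) (a J : R) (f : R -> R[i]) (l : R) : R[i] :=
  'i * (J * expR (a * l) * cos l)%:C * f l.

Definition ell2 (R : realType) (a J : R) (f : R -> R[i]) (l : R) : R[i] :=
  'i * (J * expR (a * l) * sin l)%:C * f l.

Definition ell3 (R : realType) (f : R -> R[i]) (l : R) : R[i] :=
  cderive (1 : R) f l.

Definition reduction_system (R : realType) (a e mu1 mu2 J : R)
    (phi : 'rV[R]_3 * R -> R[i]) : Prop :=
  forall (q : 'rV[R]_3) (l : R),
    let at_l := fun p => phi (p, l) in
    let at_q := fun k => phi (q, k) in
    [/\ X1 a e mu1 mu2 at_l q = - ell1 a J at_q l,
        X2 a e mu1 mu2 at_l q = - ell2 a J at_q l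
      & X3 a at_l q = - ell3 at_q l].

Definition S_phase (R : realType) (a mu1 mu2 : R) (q : 'rV[R]_3) : R :=
  expR (a * x3 q) / (1 + a ^+ 2)
    * (((a * mu1 - mu2) * x1 q - (mu1 + a * mu2) * x2 q) * cos (x3 q)
       + ((mu1 + a * mu2) * x1 q + (a * mu1 - mu2) * x2 q) * sin (x3 q)).

Definition phiJ (R : realType) (a e mu1 mu2 J : R) (Phi : R -> R[i])
    (x : 'rV[R]_3 * R) : R[i] :=
  let: (q, l) := x in
  Phi (x3 q - l)
    * cexp ('i * (e * S_phase a mu1 mu2 q)%:C
            - 'i * (J * expR (a * l) * (x1 q * cos l + x2 q * sin l))%:C).

Definition reduced_equation (R : realType) (a e m zeta mu1 mu2 J : R)
    (Phi : R -> R[i]) : Prop :=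
  forall v : R,
    cderive (1 : R) (cderive (1 : R) Phi) v
    + (2 * a)%:C * cderive (1 : R) Phi v
    + (- (2 * e * a ^+ 2 * J * expR (- (a * v)) / (1 + a ^+ 2))
         * ((a * mu1 - mu2) * cos v + (mu1 + a * mu2) * sin v)
       + a ^+ 2 * J ^+ 2 * expR (- (2 * a * v))
       + a ^+ 2 * (m ^+ 2 + 6 * zeta)
       + e ^+ 2 * a ^+ 2 * (mu1 ^+ 2 + mu2 ^+ 2) / (1 + a ^+ 2))%:C * Phi v
    = 0.

(* Main.v *)
Require Import Defs.
From mathcomp Require Import all_boot all_order all_algebra.
From mathcomp Require Import complex.
From mathcomp Require Import all_classical all_reals all_analysis.
From mathcomp Require Import ring.

Import Order.TTheory GRing.Theory Num.Theory.
Import numFieldNormedType.Exports.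

Local Open Scope ring_scope.
Local Open Scope complex_scope.

Set Implicit Arguments.
Unset Strict Implicit.
Unset Printing Implicit Defensive.

(* Write phi = chi exp(i theta), where theta = e S - T is the total phase and T
   is the argument J e^{a l} (q^1 cos l + q^2 sin l) of the partial wave. The
   system says that phi and exp(i theta) have the same logarithmic derivative
   along d/dq^1, d/dq^2 and d/dq^3 + d/dl: along the first two directions this
   is X_1, X_2, and along the third it follows because X_3 + l_3 annihilates
   both e S and T. Hence chi is invariant along these directions, so that it is
   a function of v = q^3 - l. For the reduction of the Klein-Gordon equation,
   A_3 = dS/dq^3 makes D_3 act on phi_J as Phi |-> Phi', whereas D_1 and D_2 act
   as multiplication by functions of q^3 and l, whose squares add up to the
   potential of the reduced equation. *)

(** * Directional derivatives on a normed space *)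

Lemma derivable_comp_affine (R : realType) (V W : normedModType R) (M : V -> W)
    (f : W -> R) (x v : V) (w : W) :
    (forall h : R, M (h *: v + x) = h *: w + M x) ->
  derivable (f \o M) x v = derivable f (M x) w.
Proof.
move=> ME; rewrite /derivable.
(* Both difference quotients are the same function of h, so their limits exist together. *)
by under eq_fun => h do rewrite /= ME.
Qed.

Lemma derive_comp_affine (R : realType) (V W : normedModType R) (M : V -> W)
    (f : W -> R) (x v : V) (w : W) :
    (forall h : R, M (h *: v + x) = h *: w + M x) ->
  'D_v (f \o M) x = 'D_w f (M x).
Proof.
move=> ME; rewrite /derive.
by under eq_fun => h do rewrite /= ME.
Qed.

Lemma is_derive_comp_affine (R : realType) (V W : normedModType R) (M : V -> W)
    (f : W -> R) (x v : V) (w : W) (df : R) :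
    (forall h : R, M (h *: v + x) = h *: w + M x) ->
  is_derive x v (f \o M) df <-> is_derive (M x) w f df.
Proof.
move=> ME; split=> -[df1 df2]; split.
- by rewrite -(derivable_comp_affine f ME).
- by rewrite -(derive_comp_affine f ME).
- by rewrite (derivable_comp_affine f ME).
- by rewrite (derive_comp_affine f ME).
Qed.

Lemma is_derive_line (R : realType) (V : normedModType R)
    (f : V -> R) (x v : V) (df t : R) :
  is_derive t 1 (fun s : R => f (s *: v + x)) df <->
  is_derive (t *: v + x) v f df.
Proof.
apply: (@is_derive_comp_affine _ R V (fun s : R => s *: v + x) f t 1 v df) => h.
by rewrite /GRing.scale /= mulr1 -/(GRing.scale _ _) scalerDl addrA.
Qed.

(** Restriction to a line is the bridge by which one-variable results, such as the chain rule, reach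
    directional derivatives. *)
Lemma is_derive_line0 (R : realType) (V : normedModType R)
    (f : V -> R) (x v : V) (df : R) :
  is_derive (0 : R) 1 (fun s : R => f (s *: v + x)) df <-> is_derive x v f df.
Proof. by rewrite is_derive_line scale0r add0r. Qed.

Lemma is_derive_comp1 (R : realType) (V : normedModType R) (g : R -> R)
    (f : V -> R) (x v : V) (dg df : R) :
    is_derive (f x) 1 g dg -> is_derive x v f df ->
  is_derive x v (fun y => g (f y)) (dg * df).
Proof.
move=> gdg /is_derive_line0 fdf; apply/is_derive_line0.
apply: (is_derive1_comp (f := g) (g := fun s : R => f (s *: v + x))).
by rewrite scale0r add0r.
Qed.

(** This rule and the next three are stated for functions written pointwise, the shape in which
    formulas are differentiated below. *)
Lemma is_derive_constf (R : realType) (V : normedModType R) (c : R) (x v : V) :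
  is_derive x v (fun=> c) (0 : R).
Proof. exact: (is_derive_cst (W := R) c x v). Qed.

Lemma is_derive_addf (R : realType) (V : normedModType R) (f g : V -> R)
    (x v : V) (df dg : R) :
    is_derive x v f df -> is_derive x v g dg ->
  is_derive x v (fun y => f y + g y) (df + dg).
Proof. exact: is_deriveD. Qed.

Lemma is_derive_oppf (R : realType) (V : normedModType R) (f : V -> R)
    (x v : V) (df : R) :
  is_derive x v f df -> is_derive x v (fun y => - f y) (- df).
Proof. exact: is_deriveN. Qed.

Lemma is_derive_mulf (R : realType) (V : normedModType R) (f g : V -> R)
    (x v : V) (df dg : R) :
    is_derive x v f df -> is_derive x v g dg ->
  is_derive x v (fun y => f y * g y) (df * g x + f x * dg).
Proof.
move=> fdf gdg; rewrite addrC [df * _]mulrC.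
exact: (is_deriveM (f := f) (g := g)).
Qed.

Lemma is_derive_linear (R : realType) (V : normedModType R) (L : V -> R)
    (x v : V) :
  (forall (h : R), L (h *: v + x) = h * L v + L x) -> is_derive x v L (L v).
Proof.
move=> LE; apply/is_derive_line0.
under eq_fun do rewrite LE.
apply: (is_derive_eq (f' := (1 * L v + 0 * 0) + 0)).
  exact: (is_derive_addf (is_derive_mulf (is_derive_id _ _)
    (is_derive_constf _ _ _)) (is_derive_constf _ _ _)).
by rewrite mulr0 mul1r !addr0.
Qed.

Lemma derive0_line_cst (R : realType) (V : normedModType R)
    (f : V -> R) (x v : V) (t : R) :
  (forall y, is_derive y v f 0) -> f (t *: v + x) = f x.
Proof.
move=> f0; rewrite -[in RHS](add0r x) -(scale0r v).
apply: (@is_derive_0_is_cst R (fun s : R => f (s *: v + x))) => s.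
exact/is_derive_line.
Qed.

(** The increment along h (u + w) is split into a step h u followed by a step h w. The first
    quotient tends to the derivative along u; the second is a derivative along w at a nearby point,
    and continuity of that derivative gives its limit. *)
Lemma derive_addv (R : realType) (V : normedModType R) (f : V -> R)
    (x u w : V) :
    derivable f x u -> (forall y, derivable f y w) ->
    {for x, continuous (fun y => 'D_w f y)} ->
  is_derive x (u + w) f ('D_u f x + 'D_w f x).
Proof.
move=> fu fw cw.
suff H : ((fun h : R => h^-1 *: ((f \o shift x) (h *: (u + w)) - f x)) @ 0^'
    --> ('D_u f x + 'D_w f x : R))%classic.
  split; first by apply/cvg_ex; exists ('D_u f x + 'D_w f x).
  exact: cvg_lim H.
have -> : (fun h : R => h^-1 *: ((f \o shift x) (h *: (u + w)) - f x)) =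
    (fun h : R => h^-1 *: ((f \o shift x) (h *: u) - f x)
       + h^-1 *: (f (h *: w + (h *: u + x)) - f (h *: u + x))).
  apply/funext => h /=; rewrite -scalerDr; congr (_ *: _).
  by rewrite scalerDr [_ *: u + _ *: w]addrC -addrA [RHS]addrC subrKA.
apply: cvgD; first exact: fu.
apply/cvgrPdist_lt => eps eps_gt0.
have [d /= d_gt0 dP] : exists2 d : R, 0 < d &
    forall y, `|x - y| < d -> `|'D_w f x - 'D_w f y| < eps.
  move/cvgrPdist_lt: cw => /(_ eps eps_gt0) /nbhs_normP[d d_gt0 dP].
  by exists d => // y; exact: dP.
(* The points h u + c w + x with |c| <= |h| lie within |h| (|u| + |w|) of x; the summand 1 makes K
   positive. *)
set K := `|u| + `|w| + 1.
have K_gt0 : 0 < K by rewrite ltr_wpDl// addr_ge0.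
(* The mean value theorem along w, on [0, h] or [h, 0] according to the sign of h, supplies the
   intermediate point [c h]. *)
have [c cP] : exists c : R -> R, forall h, `|c h| <= `|h| /\
    f (h *: w + (h *: u + x)) - f (h *: u + x)
      = 'D_w f (c h *: w + (h *: u + x)) * h.
  suff /choice[c] : forall h : R, exists c : R, `|c| <= `|h| /\
      f (h *: w + (h *: u + x)) - f (h *: u + x)
        = 'D_w f (c *: w + (h *: u + x)) * h by exists c.
  move=> h; set y := h *: u + x.
  have dl (s : R) : is_derive s 1 (fun t : R => f (t *: w + y)) ('D_w f (s *: w + y)).
    exact/is_derive_line/derivableP.
  have cl a b : ({within `[a, b], continuous (fun t : R => f (t *: w + y))})%classic.
    apply/continuous_subspaceT => t.
    by apply/differentiable_continuous/derivable1_diffP; apply: ex_derive.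
  have [h0|h0] := leP 0 h.
    have [c] := @MVT_segment R _ _ 0 h h0 (fun s _ => dl s) (cl 0 h).
    rewrite in_itv /= scale0r add0r subr0 => /andP[c0 ch] ->.
    by exists c; split=> //; rewrite !ger0_norm.
  have [c] := @MVT_segment R _ _ h 0 (ltW h0) (fun s _ => dl s) (cl h 0).
  rewrite in_itv /= scale0r add0r sub0r => /andP[ch c0] E.
  exists c; split; first by rewrite (ler0_norm c0) (ler0_norm (ltW h0)) lerN2.
  by rewrite -opprB E mulrN opprK.
near=> h.
have h_neq0 : h != 0 by near: h; exact: nbhs_dnbhs_neq.
have hd : `|h| < d / K.
  near: h; apply: dnbhs0_lt; exact: divr_gt0.
have [ch ->] := cP h.
rewrite /GRing.scale /= mulrC mulfK//.
apply: dP.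
rewrite distrC addrA addrK (le_lt_trans (ler_normD _ _))// !normrZ.
rewrite (@le_lt_trans _ _ (`|h| * K))// -?ltr_pdivlMr// /K mulrDr mulr1 mulrDr.
rewrite addrC -addrA lerD2l (le_trans (ler_wpM2r _ ch))// lerDl//.
Unshelve. all: by end_near. Qed.

(** * Smooth real-valued functions *)

Section Smoothness.
Variable R : realType.
Implicit Types V W : normedModType R.

(** The last vector of the list acts first, so differentiating f beforehand amounts to appending v
    to the list. *)
Lemma rsmooth_derive V (f : V -> R) (v : V) :
  rsmooth f -> rsmooth (fun x => 'D_v f x).
Proof. by move=> fs vs; have := fs (rcons vs v); rewrite /iter_derive foldr_rcons. Qed.

Lemma rsmooth_is_derive V (f : V -> R) (x v : V) :
  rsmooth f -> is_derive x v f ('D_v f x).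
Proof. by move=> /(_ [::])[_ /(_ v x)] ?; exact: derivableP. Qed.

Lemma rsmooth_continuous V (f : V -> R) : rsmooth f -> continuous f.
Proof. by move=> /(_ [::])[]. Qed.

(* Closure of the smooth functions under the operations below, in a form whose
   stability under differentiation is a structural induction. *)
Inductive smooth_closure V : (V -> R) -> Prop :=
| SC_smooth f of rsmooth f : smooth_closure f
| SC_cst c : smooth_closure (fun=> c)
| SC_linear L of (forall (h : R) x y, L (h *: y + x) = h * L y + L x)
    & continuous L : smooth_closure L
| SC_add f g of smooth_closure f & smooth_closure g :
    smooth_closure (fun x => f x + g x)
| SC_mul f g of smooth_closure f & smooth_closure g :
    smooth_closure (fun x => f x * g x)
| SC_exp f of smooth_closure f : smooth_closure (fun x => expR (f x))
| SC_sin f of smooth_closure f : smooth_closure (fun x => sin (f x))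
| SC_cos f of smooth_closure f : smooth_closure (fun x => cos (f x)).

Lemma SC_opp V (f : V -> R) :
  smooth_closure f -> smooth_closure (fun x => - f x).
Proof.
move=> sf; under eq_fun do rewrite -mulN1r.
by apply: SC_mul => //; exact: SC_cst.
Qed.

Lemma smooth_closure_continuous V (f : V -> R) :
  smooth_closure f -> continuous f.
Proof.
elim=> {f} [f /rsmooth_continuous//|c|//|f g _ cf _ cg|f g _ cf _ cg|
  f _ cf|f _ cf|f _ cf] x.
- exact: cst_continuous.
- by apply: continuousD; [exact: cf|exact: cg].
- by apply: continuousM; [exact: cf|exact: cg].
- apply: (continuous_comp (g := expR)); [exact: cf|exact: continuous_expR].
- apply: (continuous_comp (g := sin)); [exact: cf|exact: continuous_sin].
- apply: (continuous_comp (g := cos)); [exact: cf|exact: continuous_cos].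
Qed.

Lemma smooth_closure_derive V (f : V -> R) (v : V) : smooth_closure f ->
  exists2 df, smooth_closure df & forall x, is_derive x v f (df x).
Proof.
elim=> {f} [f fs|c|L LE _|f g _ [df ? fdf] _ [dg ? gdg]
  |f g sf [df ? fdf] sg [dg ? gdg]|f sf [df ? fdf]|f sf [df ? fdf]
  |f sf [df ? fdf]].
- exists (fun x => 'D_v f x); first exact/SC_smooth/rsmooth_derive.
  by move=> x; exact: rsmooth_is_derive.
- exists (fun=> 0); first exact: SC_cst.
  by move=> x; exact: is_derive_constf.
- exists (fun=> L v); first exact: SC_cst.
  by move=> x; exact: is_derive_linear.
- exists (fun x => df x + dg x); first exact: SC_add.
  by move=> x; exact: is_derive_addf.
- exists (fun x => df x * g x + f x * dg x).
    by apply: SC_add; exact: SC_mul.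
  by move=> x; exact: is_derive_mulf.
- exists (fun x => expR (f x) * df x); first by apply: SC_mul => //; exact: SC_exp.
  by move=> x; apply: is_derive_comp1; exact: is_derive_expR.
- exists (fun x => cos (f x) * df x).
    by apply: SC_mul => //; exact: SC_cos.
  by move=> x; apply: is_derive_comp1; exact: is_derive_sin.
- exists (fun x => -1 * sin (f x) * df x).
    apply: SC_mul => //; apply: SC_mul; [exact: SC_cst|exact: SC_sin].
  by move=> x; rewrite mulN1r; apply: is_derive_comp1; exact: is_derive_cos.
Qed.

(** Every iterated derivative stays in the closure, and members of the closure are continuous and
    derivable in all directions. *)
Lemma smooth_closureW V (f : V -> R) : smooth_closure f -> rsmooth f.
Proof.
move=> sf vs.
have {sf} : smooth_closure (iter_derive vs f).
  elim: vs => //= v vs /(@smooth_closure_derive _ _ v)[df sdf dfE].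
  suff -> : 'D_v (iter_derive vs f) = df by [].
  by apply/funext => x; have [_ ->] := dfE x.
move=> sf; split; first exact: smooth_closure_continuous.
by move=> v x; have [df _ /(_ x)[]] := smooth_closure_derive v sf.
Qed.

(** Iterated derivatives of f o M along [vs] are those of f along the images [map M vs], composed
    with M. *)
Lemma rsmooth_comp_linear V W (M : V -> W) (f : W -> R) :
    (forall (h : R) x y, M (h *: y + x) = h *: M y + M x) ->
  continuous M -> rsmooth f -> rsmooth (fun x => f (M x)).
Proof.
move=> ME cM fs vs.
have -> : iter_derive vs (fun x => f (M x)) = iter_derive (map M vs) f \o M.
  elim: vs => //= v vs ->; apply/funext => x.
  exact: derive_comp_affine.
have [cf df] := fs (map M vs); split.
  by move=> x; apply: continuous_comp; [exact: cM|exact: cf].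
move=> v x.
by rewrite (@derivable_comp_affine _ _ _ M _ x v (M v)).
Qed.

End Smoothness.

(** * Derivatives of complex-valued functions *)

Section ComplexDerivative.
Variable R : realType.
Implicit Types V W : normedModType R.

Lemma complex_ext (z w : R[i]) :
  complex.Re z = complex.Re w -> complex.Im z = complex.Im w -> z = w.
Proof. by case: z w => [? ?] [? ?] /= -> ->. Qed.

Lemma Re_addc (z w : R[i]) :
  complex.Re (z + w) = complex.Re z + complex.Re w.
Proof. by case: z w => [? ?] [? ?]. Qed.

Lemma Im_addc (z w : R[i]) :
  complex.Im (z + w) = complex.Im z + complex.Im w.
Proof. by case: z w => [? ?] [? ?]. Qed.

(** The difference is spelled as a sum with an opposite, to match the rules for sums and
    opposites. *)
Lemma Re_mulc (z w : R[i]) : complex.Re (z * w) =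
  complex.Re z * complex.Re w + - (complex.Im z * complex.Im w).
Proof. by case: z w => [? ?] [? ?]. Qed.

Lemma Im_mulc (z w : R[i]) : complex.Im (z * w) =
  complex.Re z * complex.Im w + complex.Im z * complex.Re w.
Proof. by case: z w => [? ?] [? ?]. Qed.

(** As a relation this also asserts that both components are derivable, which an equation on
    [cderive] would not. *)
Definition is_cderive V (x v : V) (f : V -> R[i]) (df : R[i]) : Prop :=
  is_derive x v (fun y => complex.Re (f y)) (complex.Re df) /\
  is_derive x v (fun y => complex.Im (f y)) (complex.Im df).

Lemma is_cderiveE V (x v : V) (f : V -> R[i]) (df : R[i]) :
  is_cderive x v f df -> cderive v f x = df.
Proof. by move=> [[_ dr] [_ di]]; rewrite /cderive dr di; case: df {dr di}. Qed.

Lemma is_cderive_eq V (x v : V) (f : V -> R[i]) (df dg : R[i]) :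
  is_cderive x v f df -> df = dg -> is_cderive x v f dg.
Proof. by move=> ? <-. Qed.

Lemma is_cderive_real V (x v : V) (f : V -> R) (df : R) :
  is_derive x v f df -> is_cderive x v (fun y => (f y)%:C) df%:C.
Proof. by move=> fdf; split=> //=; exact: is_derive_constf. Qed.

Lemma is_cderive_cst V (x v : V) (c : R[i]) : is_cderive x v (fun=> c) 0.
Proof. by split; exact: is_derive_constf. Qed.

Lemma is_cderive_mul V (x v : V) (f g : V -> R[i]) (df dg : R[i]) :
    is_cderive x v f df -> is_cderive x v g dg ->
  is_cderive x v (fun y => f y * g y) (df * g x + f x * dg).
Proof.
move=> [fr fi] [gr gi]; split.
  under eq_fun do rewrite Re_mulc.
  apply: (is_derive_eq (is_derive_addf (is_derive_mulf fr gr)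
    (is_derive_oppf (is_derive_mulf fi gi)))).
  by rewrite Re_addc !Re_mulc; ring.
under eq_fun do rewrite Im_mulc.
apply: (is_derive_eq (is_derive_addf (is_derive_mulf fr gi)
  (is_derive_mulf fi gr))).
by rewrite Im_addc !Im_mulc; ring.
Qed.

Lemma is_cderive_comp_affine V W (M : V -> W) (f : W -> R[i])
    (x v : V) (w : W) (df : R[i]) :
    (forall h : R, M (h *: v + x) = h *: w + M x) ->
  is_cderive (M x) w f df -> is_cderive x v (fun y => f (M y)) df.
Proof.
move=> ME [fr fi]; split.
  exact/(is_derive_comp_affine (fun y => complex.Re (f y)) _ ME).
exact/(is_derive_comp_affine (fun y => complex.Im (f y)) _ ME).
Qed.

Lemma is_cderive_comp1 V (f : R -> R[i]) (h : V -> R) (x v : V)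
    (df : R[i]) (dh : R) :
    is_cderive (h x) 1 f df -> is_derive x v h dh ->
  is_cderive x v (fun y => f (h y)) (df * dh%:C).
Proof.
move=> [fr fi] hdh; split.
  apply: (is_derive_eq (is_derive_comp1 fr hdh)).
  by rewrite Re_mulc /=; ring.
apply: (is_derive_eq (is_derive_comp1 fi hdh)).
by rewrite Im_mulc /=; ring.
Qed.

Lemma smooth_is_cderive V (f : V -> R[i]) (x v : V) :
  smooth f -> is_cderive x v f (cderive v f x).
Proof. by move=> [fr fi]; split; exact: rsmooth_is_derive. Qed.

Lemma smooth_cderive V (f : V -> R[i]) (v : V) :
  smooth f -> smooth (cderive v f).
Proof. by move=> [fr fi]; split; exact: rsmooth_derive. Qed.

(** The third equation of the system involves d/dq^3 and d/dl separately; this combines them into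
    one derivative along the diagonal direction. *)
Lemma smooth_cderiveD V (f : V -> R[i]) (x v w : V) : smooth f ->
  is_cderive x (v + w) f (cderive v f x + cderive w f x).
Proof.
move=> [fr fi]; split=> /=; apply: derive_addv.
- by have [] := rsmooth_is_derive x v fr.
- by move=> y; have [] := rsmooth_is_derive y w fr.
- exact/rsmooth_continuous/rsmooth_derive.
- by have [] := rsmooth_is_derive x v fi.
- by move=> y; have [] := rsmooth_is_derive y w fi.
- exact/rsmooth_continuous/rsmooth_derive.
Qed.

Lemma cderive0_line_cst V (f : V -> R[i]) (x v : V) (t : R) :
  (forall y, is_cderive y v f 0) -> f (t *: v + x) = f x.
Proof.
move=> f0; apply: complex_ext.
  by apply: (derive0_line_cst (f := fun y => complex.Re (f y))) => y; have [] := f0 y.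
by apply: (derive0_line_cst (f := fun y => complex.Im (f y))) => y; have [] := f0 y.
Qed.

(** This is exp(i t) for real t; the exponent in phi_J is purely imaginary. *)
Definition cis (t : R) : R[i] := cos t +i* sin t.

Lemma cexp_imaginary (t s : R) : cexp ('i * t%:C - 'i * s%:C) = cis (t - s).
Proof.
have -> : 'i * t%:C - 'i * s%:C = 0 +i* (t - s).
  by apply: complex_ext; rewrite ?(Re_addc, Im_addc) /=; ring.
by rewrite /cexp /= expR0 mul1r.
Qed.

Lemma cisN (t : R) : cis (- t) * cis t = 1.
Proof.
apply: complex_ext => /=; rewrite cosN sinN mulNr.
  by rewrite opprK -!expr2 cos2Dsin2.
by rewrite mulrC subrr.
Qed.

Lemma cis_neq0 (t : R) : cis t != 0.
Proof.
apply/eqP => t0; have /eqP := cisN t.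
by rewrite t0 mulr0 eq_sym oner_eq0.
Qed.

Lemma is_cderive_cis V (x v : V) (f : V -> R) (df : R) :
    is_derive x v f df ->
  is_cderive x v (fun y => cis (f y)) ('i * df%:C * cis (f x)).
Proof.
move=> fdf; split=> /=.
  apply: (is_derive_eq (is_derive_comp1 (is_derive_cos _) fdf)).
  by ring.
apply: (is_derive_eq (is_derive_comp1 (is_derive_sin _) fdf)).
by ring.
Qed.

Lemma smooth_comp_linear V W (M : V -> W) (f : W -> R[i]) :
    (forall (h : R) x y, M (h *: y + x) = h *: M y + M x) ->
  continuous M -> smooth f -> smooth (fun x => f (M x)).
Proof.
move=> ME cM [fr fi]; split.
  exact: (rsmooth_comp_linear ME cM fr).
exact: (rsmooth_comp_linear ME cM fi).
Qed.

Lemma smooth_mul_cis V (f : V -> R[i]) (t : V -> R) :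
  smooth f -> smooth_closure t -> smooth (fun x => f x * cis (t x)).
Proof.
move=> [fr fi] ts; split; apply: smooth_closureW.
  under eq_fun do rewrite Re_mulc.
  apply: SC_add; first by apply: SC_mul; [exact: SC_smooth|exact: SC_cos].
  apply: SC_opp.
  by apply: SC_mul; [exact: SC_smooth|exact: SC_sin].
under eq_fun do rewrite Im_mulc.
apply: SC_add; first by apply: SC_mul; [exact: SC_smooth|exact: SC_sin].
by apply: SC_mul; [exact: SC_smooth|exact: SC_cos].
Qed.

End ComplexDerivative.

(** * The phase and its differential on the product of q-space and the l-line *)

Lemma is_derive_coord (R : realType) (b : 'I_3) (x w : 'rV[R]_3 * R) :
  is_derive x w (fun y : 'rV[R]_3 * R => y.1 0 b) (w.1 0 b).
Proof.
apply: (is_derive_linear (L := fun y : 'rV[R]_3 * R => y.1 0 b)) => h.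
by rewrite !mxE.
Qed.

Lemma is_derive_snd (R : realType) (x w : 'rV[R]_3 * R) :
  is_derive x w (fun y : 'rV[R]_3 * R => y.2) w.2.
Proof. exact: (is_derive_linear (L := fun y : 'rV[R]_3 * R => y.2)). Qed.

(** The rule is chosen by the shape of the function, constants first, while the derivative is built
    up as an existential variable. [notypeclasses refine] leaves the premises, which are instances
    of a class, as goals for the next round. *)
Ltac derive_rule := first
  [ notypeclasses refine (is_derive_constf _ _ _)
  | notypeclasses refine (is_derive_coord _ _ _)
  | notypeclasses refine (is_derive_snd _ _)
  | notypeclasses refine (is_derive_addf _ _)
  | notypeclasses refine (is_derive_oppf _)
  | notypeclasses refine (is_derive_mulf _ _)
  | notypeclasses refine (is_derive_comp1 (is_derive_expR _) _)
  | notypeclasses refine (is_derive_comp1 (is_derive_sin _) _)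
  | notypeclasses refine (is_derive_comp1 (is_derive_cos _) _) ].

Section Phase.
Variables (R : realType) (a e mu1 mu2 J : R).
Implicit Types (q u : 'rV[R]_3) (x w : 'rV[R]_3 * R).

Let alpha := a * mu1 - mu2.
Let beta := mu1 + a * mu2.

Lemma sqr_add1_neq0 : 1 + a ^+ 2 != 0.
Proof. by rewrite gt_eqF// ltr_wpDr// sqr_ge0. Qed.

(** With the gradient components dS1 and dS2 of S, the operators X_1 and X_2 are d/dq^b - i e
    dS/dq^b for b = 1, 2. *)
Definition dS1 q : R := expR (a * x3 q) / (1 + a ^+ 2)
  * (alpha * cos (x3 q) + beta * sin (x3 q)).
Definition dS2 q : R := expR (a * x3 q) / (1 + a ^+ 2)
  * (alpha * sin (x3 q) - beta * cos (x3 q)).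

(* The potential is the gradient component dS/dq^3, so that the gauge factor
   exp (i e S) removes it. *)
Definition dS3 q : R := potential a mu1 mu2 q 0 2.

Lemma dS3E q : dS3 q = expR (a * x3 q)
  * (mu1 * (x1 q * cos (x3 q) + x2 q * sin (x3 q))
     + mu2 * (x1 q * sin (x3 q) - x2 q * cos (x3 q))).
Proof. by rewrite /dS3 /potential !mxE eqxx mulr1. Qed.

(** In the q^3-component the denominator cancels, because a alpha + beta = (1 + a^2) mu1 and a beta
    - alpha = (1 + a^2) mu2. *)
Lemma is_derive_S_phase x w :
  is_derive x w (fun y : 'rV[R]_3 * R => S_phase a mu1 mu2 y.1)
    (dS1 x.1 * x1 w.1 + dS2 x.1 * x2 w.1 + dS3 x.1 * x3 w.1).
Proof.
apply: is_derive_eq.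
  rewrite /S_phase /x1 /x2 /x3.
  by repeat derive_rule.
rewrite dS3E /dS1 /dS2 /x1 /x2 /x3 /alpha /beta.
by field; exact: sqr_add1_neq0.
Qed.

Definition wave_phase x : R :=
  J * expR (a * x.2) * (x1 x.1 * cos x.2 + x2 x.1 * sin x.2).

Definition dT1 (l : R) : R := J * expR (a * l) * cos l.
Definition dT2 (l : R) : R := J * expR (a * l) * sin l.
Definition dTl x : R := J * expR (a * x.2) *
  (a * (x1 x.1 * cos x.2 + x2 x.1 * sin x.2)
   - x1 x.1 * sin x.2 + x2 x.1 * cos x.2).

Lemma is_derive_wave_phase x w :
  is_derive x w wave_phase
    (dT1 x.2 * x1 w.1 + dT2 x.2 * x2 w.1 + dTl x * w.2).
Proof.
apply: is_derive_eq.
  rewrite /wave_phase /x1 /x2 /x3.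
  by repeat derive_rule.
rewrite /dT1 /dT2 /dTl /x1 /x2 /x3.
by ring.
Qed.

Definition phase x : R := e * S_phase a mu1 mu2 x.1 - wave_phase x.

Definition dphase x w : R :=
  (e * dS1 x.1 - dT1 x.2) * x1 w.1 + (e * dS2 x.1 - dT2 x.2) * x2 w.1
  + e * dS3 x.1 * x3 w.1 - dTl x * w.2.

Lemma is_derive_phase x w : is_derive x w phase (dphase x w).
Proof.
apply: (is_derive_eq (is_derive_addf
  (is_derive_mulf (is_derive_constf e _ _) (is_derive_S_phase x w))
  (is_derive_oppf (is_derive_wave_phase x w)))).
by rewrite /dphase; ring.
Qed.

(* X_3 + l_3 annihilates the total phase. *)
Lemma dphase_flow x :
  dphase x (delta_mx 0 2, 1) =
  (a * x1 x.1 + x2 x.1) * dphase x (delta_mx 0 0, 0)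
  - (x1 x.1 - a * x2 x.1) * dphase x (delta_mx 0 1, 0).
Proof.
rewrite /dphase dS3E /dS1 /dS2 /dT1 /dT2 /dTl /x1 /x2 /x3 !mxE /= /alpha /beta.
by field; exact: sqr_add1_neq0.
Qed.

Lemma phiJE (Phi : R -> R[i]) x :
  phiJ a e mu1 mu2 J Phi x = Phi (x3 x.1 - x.2) * cis (phase x).
Proof. by case: x => q l; rewrite /phiJ cexp_imaginary. Qed.

(** The argument q^3 - l of Phi changes at rate [x3 w.1 - w.2], which vanishes in the directions
    d/dq^1, d/dq^2 and d/dq^3 + d/dl; there only the phase contributes. *)
Lemma is_cderive_phiJ (Phi : R -> R[i]) x w : smooth Phi ->
  is_cderive x w (phiJ a e mu1 mu2 J Phi)
    ((cderive (1 : R) Phi (x3 x.1 - x.2) * (x3 w.1 - w.2)%:C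
      + 'i * (dphase x w)%:C * Phi (x3 x.1 - x.2)) * cis (phase x)).
Proof.
move=> Ps.
have -> : phiJ a e mu1 mu2 J Phi = fun x => Phi (x3 x.1 - x.2) * cis (phase x).
  by apply/funext => y; rewrite phiJE.
apply: is_cderive_eq.
  apply: is_cderive_mul.
    apply: is_cderive_comp1.
      exact: (smooth_is_cderive _ _ Ps).
    exact: (is_derive_addf (is_derive_coord 2 x w)
      (is_derive_oppf (is_derive_snd x w))).
  exact: (is_cderive_cis (is_derive_phase x w)).
rewrite /x3.
by ring.
Qed.

End Phase.

(** * Solutions of the first-order system *)

Lemma ord3_cases (b : 'I_3) : [\/ b = 0, b = 1 | b = 2].
Proof.
by case: b => [[|[|[|b]]] lt_b3] //;
  [constructor 1|constructor 2|constructor 3]; exact: val_inj.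
Qed.

Section Reduction.
Variables (R : realType) (a e mu1 mu2 J : R).
Implicit Types (q u : 'rV[R]_3) (x w : 'rV[R]_3 * R) (phi : 'rV[R]_3 * R -> R[i]).

Local Notation ph := (phase a e mu1 mu2 J).
Local Notation dph := (dphase a e mu1 mu2 J).
Local Notation phiJ := (phiJ a e mu1 mu2 J).

Lemma is_cderive_slice_l phi q l u df :
  is_cderive (q, l) (u, 0) phi df -> is_cderive q u (fun p => phi (p, l)) df.
Proof.
apply: (is_cderive_comp_affine (M := fun p => (p, l))) => h.
by congr pair; rewrite /= scaler0 add0r.
Qed.

Lemma is_cderive_slice_q phi q l df :
  is_cderive (q, l) (0, 1 : R) phi df ->
  is_cderive l (1 : R) (fun k => phi (q, k)) df.
Proof.
apply: (is_cderive_comp_affine (M := fun k => (q, k))) => h.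
by congr pair; rewrite /= scaler0 add0r.
Qed.

(** The first two equations determine d1 and d2; inserted into the third, they turn it into the
    logarithmic derivative along d/dq^3 + d/dl by [dphase_flow]. *)
Lemma reduction_systemE phi q l d1 d2 d3 dl :
    is_cderive (q, l) (delta_mx 0 0, 0) phi d1 ->
    is_cderive (q, l) (delta_mx 0 1, 0) phi d2 ->
    is_cderive (q, l) (delta_mx 0 2, 0) phi d3 ->
    is_cderive (q, l) (0, 1 : R) phi dl ->
  [/\ X1 a e mu1 mu2 (fun p => phi (p, l)) q = - ell1 a J (fun k => phi (q, k)) l,
      X2 a e mu1 mu2 (fun p => phi (p, l)) q = - ell2 a J (fun k => phi (q, k)) l
    & X3 a (fun p => phi (p, l)) q = - ell3 (fun k => phi (q, k)) l]
  <->
  [/\ d1 = 'i * (dph (q, l) (delta_mx 0 0, 0))%:C * phi (q, l),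
      d2 = 'i * (dph (q, l) (delta_mx 0 1, 0))%:C * phi (q, l)
    & d3 + dl = 'i * (dph (q, l) (delta_mx 0 2, 1))%:C * phi (q, l)].
Proof.
move=> h1 h2 h3 hl.
rewrite /X1 /X2 /X3 /ell3 /partial.
rewrite (is_cderiveE (is_cderive_slice_l h1)) (is_cderiveE (is_cderive_slice_l h2)).
rewrite (is_cderiveE (is_cderive_slice_l h3)) (is_cderiveE (is_cderive_slice_q hl)).
rewrite dphase_flow /ell1 /ell2 /=.
have -> : dph (q, l) (delta_mx 0 0, 0) =
    e * dS1 a mu1 mu2 q - dT1 a J l.
  by rewrite /dphase /x1 /x2 /x3 !mxE /=; ring.
have -> : dph (q, l) (delta_mx 0 1, 0) =
    e * dS2 a mu1 mu2 q - dT2 a J l.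
  by rewrite /dphase /x1 /x2 /x3 !mxE /=; ring.
have -> : e * expR (a * x3 q) / (1 + a ^+ 2) *
    ((a * mu1 - mu2) * cos (x3 q) + (mu1 + a * mu2) * sin (x3 q)) =
    e * dS1 a mu1 mu2 q by rewrite /dS1 !mulrA.
have -> : e * expR (a * x3 q) / (1 + a ^+ 2) *
    ((mu1 + a * mu2) * cos (x3 q) - (a * mu1 - mu2) * sin (x3 q)) =
    - (e * dS2 a mu1 mu2 q) by rewrite /dS2; field; exact: sqr_add1_neq0.
rewrite -/(dT1 a J l) -/(dT2 a J l).
(* From here on only linear algebra in free complex variables remains. *)
move: (e * dS1 _ _ _ _) (e * dS2 _ _ _ _) (dT1 _ _ _) (dT2 _ _ _) => A B C D.
move: (a * _ + _) (_ - a * _) (phi _) => m n p {h1 h2 h3 hl}.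
rewrite !(rmorphB, rmorphN, rmorphM) /=.
move: A%:C B%:C C%:C D%:C m%:C n%:C => {}A {}B {}C {}D {}m {}n.
split=> -[E1 E2 E3].
  have F1 : d1 = 'i * (A - C) * p by rewrite -(subrK ('i * A * p) d1) E1; ring.
  have F2 : d2 = 'i * (B - D) * p by rewrite -(addrK ('i * - B * p) d2) E2; ring.
  split=> //; rewrite -(opprK dl) -E3 F1 F2; ring.
split; rewrite ?E1 ?E2; [ring|ring|].
by rewrite -(addrK dl d3) E3; ring.
Qed.

(** Phi is composed with the continuous linear form q^3 - l, and the phase is built from coordinates
    by the operations of [smooth_closure]. *)
Lemma smooth_phiJ (Phi : R -> R[i]) : smooth Phi -> smooth (phiJ Phi).
Proof.
move=> Ps.
have -> : phiJ Phi = fun x => Phi (x3 x.1 - x.2) * cis (ph x).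
  by apply/funext => y; rewrite phiJE.
have coordC b : continuous (fun y : 'rV[R]_3 * R => y.1 0 b).
  move=> y; apply: (continuous_comp (f := fst) (g := fun q : 'rV[R]_3 => q 0 b)).
    exact: cvg_fst.
  exact: coord_continuous.
have sndC : continuous (fun y : 'rV[R]_3 * R => y.2) by move=> y; exact: cvg_snd.
have coordS b : smooth_closure (fun y : 'rV[R]_3 * R => y.1 0 b).
  by apply: SC_linear => // h x y; rewrite !mxE.
have sndS : smooth_closure (fun y : 'rV[R]_3 * R => y.2) by apply: SC_linear.
apply: smooth_mul_cis.
  apply: (smooth_comp_linear (M := fun x => x3 x.1 - x.2)) => //.
    by move=> h x y; rewrite /x3 /= !mxE /GRing.scale /=; ring.
  by move=> x; apply: cvgB; [exact: coordC|exact: sndC].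
rewrite /phase /S_phase /wave_phase /x1 /x2 /x3.
repeat first [exact: SC_cst | exact: coordS | exact: sndS | apply: SC_add
  | apply: SC_opp   | apply: SC_mul | apply: SC_exp | apply: SC_cos | apply: SC_sin].
Qed.

Lemma phiJ_reduction_system (Phi : R -> R[i]) :
  smooth Phi -> reduction_system a e mu1 mu2 J (phiJ Phi).
Proof.
move=> Ps q l.
have h w := @is_cderive_phiJ R a e mu1 mu2 J Phi (q, l) w Ps.
apply/(reduction_systemE (h _) (h _) (h _) (h _)).
have -> : dph (q, l) (delta_mx 0 2, 1) =
    dph (q, l) (delta_mx 0 2, 0) + dph (q, l) (0, 1).
  by rewrite /dphase /x1 /x2 /x3 !mxE /=; ring.
rewrite !phiJE /= /x3 !mxE /=.
by split; ring.
Qed.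

(** Phi is the restriction of phi to the line q^1 = q^2 = l = 0, where the phase vanishes; the
    invariance directions carry any point to this line without changing v. *)
Lemma reduction_system_phiJ phi :
    smooth phi -> reduction_system a e mu1 mu2 J phi ->
  forall x, phi x = phiJ (fun v => phi (v *: delta_mx 0 2, 0)) x.
Proof.
move=> ps sys.
pose chi x := phi x * cis (- ph x).
have chi0 x w : cderive w phi x = 'i * (dph x w)%:C * phi x ->
    is_cderive x w chi 0.
  move=> Dphi; apply: is_cderive_eq.
    apply: (is_cderive_mul (f := phi) (g := fun x => cis (- ph x))).
      exact: (smooth_is_cderive x w ps).
    exact: (is_cderive_cis (is_derive_oppf (is_derive_phase a e mu1 mu2 J x w))).
  by rewrite Dphi rmorphN /=; ring.
have sysx (x : 'rV[R]_3 * R) := (reduction_systemE (smooth_is_cderive (x.1, x.2) _ ps)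
  (smooth_is_cderive _ _ ps) (smooth_is_cderive _ _ ps)
  (smooth_is_cderive _ _ ps)).1 (sys x.1 x.2).
have chi1 x : is_cderive x (delta_mx 0 0, 0) chi 0.
  by apply: chi0; case: x => q l; have [] := sysx (q, l).
have chi2 x : is_cderive x (delta_mx 0 1, 0) chi 0.
  by apply: chi0; case: x => q l; have [] := sysx (q, l).
have chi3 x : is_cderive x (delta_mx 0 2, 1) chi 0.
  apply: chi0; case: x => q l; have [_ _ /= <-] := sysx (q, l).
  (* The system only controls the sum of the two partial derivatives; smoothness of phi identifies
     it with the derivative along the sum of the directions. *)
  have -> : (delta_mx 0 2, 1) = (delta_mx 0 2, 0) + (0, 1) :> 'rV[R]_3 * R.
    by congr pair; rewrite /= ?addr0 ?add0r.
  exact: is_cderiveE (smooth_cderiveD _ _ _ ps).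
move=> [q l].
(* Three moves along the invariance directions cancel q^1, then q^2, then l; the last one shifts q^3
   to q^3 - l. *)
pose y1 : 'rV[R]_3 * R := - x1 q *: (delta_mx 0 0, 0) + (q, l).
pose y2 : 'rV[R]_3 * R := - x2 q *: (delta_mx 0 1, 0) + y1.
pose y3 : 'rV[R]_3 * R := - l *: (delta_mx 0 2, 1) + y2.
have y3E : y3 = ((x3 q - l) *: delta_mx 0 2, 0).
  congr pair; last by rewrite /= /GRing.scale /=; ring.
  by apply/rowP => b; rewrite !mxE /x1 /x2 /x3; have [->|->|->] := ord3_cases b;
    rewrite /=; ring.
have : chi (q, l) = chi ((x3 q - l) *: delta_mx 0 2, 0).
  rewrite -y3E -(cderive0_line_cst (q, l) (- x1 q) chi1).
  by rewrite -(cderive0_line_cst y1 (- x2 q) chi2) -(cderive0_line_cst y2 (- l) chi3).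
rewrite /chi => chiE.
have -> : phi (q, l) = phi (q, l) * cis (- ph (q, l)) * cis (ph (q, l)).
  by rewrite -mulrA cisN mulr1.
rewrite chiE phiJE /=.
(* Both S and T are linear in (q^1, q^2), which is zero here. *)
have -> : ph ((x3 q - l) *: delta_mx 0 2, 0) = 0.
  by rewrite /phase /S_phase /wave_phase /x1 /x2 !mxE /=; ring.
by rewrite oppr0 /cis cos0 sin0 mulr1.
Qed.

End Reduction.

(** * Reduction of the Klein-Gordon equation *)

Section KleinGordon.
Variables (R : realType) (a e m zeta mu1 mu2 J : R).
Hypothesis a_gt0 : 0 < a.
Implicit Types (q p : 'rV[R]_3) (l : R) (f : 'rV[R]_3 -> R[i]) (Phi : R -> R[i]).

Local Notation E2 q := (expR (2 * a * x3 q)).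
Local Notation phiJ := (phiJ a e mu1 mu2 J).
Local Notation cov := (covariant e (potential a mu1 mu2)).

Lemma sum_ord3 (V : nmodType) (F : 'I_3 -> V) : \sum_b F b = F 0 + F 1 + F 2.
Proof.
rewrite !big_ord_recl big_ord0 addr0 addrA.
by congr (F _ + F _ + F _); exact: val_inj.
Qed.

Lemma det_metric q : \det (metric a q) = (a * E2 q) ^+ 2.
Proof.
rewrite /metric det_diag !big_ord_recl big_ord0 !mxE /=.
by ring.
Qed.

Lemma sqrt_det_metric q : Num.sqrt `|\det (metric a q)| = a * E2 q.
Proof.
by rewrite det_metric ger0_norm ?sqr_ge0// sqrtr_sqr gtr0_norm// mulr_gt0// expR_gt0.
Qed.

Lemma invmx_metric q : invmx (metric a q) =
  diag_mx (\row_(b < 3) (if b == 2 then a ^- 2 else - (E2 q)^-1)).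
Proof.
set D := diag_mx _.
have gD : metric a q *m D = 1%:M.
  rewrite /metric /D mulmx_diag; apply/matrixP => b c; rewrite !mxE.
  have [->|->|->] := ord3_cases b; rewrite /= ?mulrNN divff//.
  - by rewrite gt_eqF// expR_gt0.
  - by rewrite gt_eqF// expR_gt0.
  - by rewrite expf_neq0// gt_eqF.
have [gU _] := mulmx1_unit gD.
by rewrite -[RHS](mulKmx gU) gD mulmx1.
Qed.

(** The weights |g|^(1/2) g^bb are -a, -a and e^(2 a q^3) / a, so only the third one depends on
    q. *)
Lemma klein_gordon_metric (A : 'rV[R]_3 -> 'rV[R]_3) f q :
  klein_gordon (metric a) A e m zeta f q =
  ((a * E2 q)^-1)%:C *
    (covariant e A 0 (fun p => (- a)%:C * covariant e A 0 f p) q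
     + covariant e A 1 (fun p => (- a)%:C * covariant e A 1 f p) q
     + covariant e A 2 (fun p => (E2 p / a)%:C * covariant e A 2 f p) q)
  + (6 * zeta + m ^+ 2)%:C * f q.
Proof.
rewrite /klein_gordon sqrt_det_metric sum_ord3.
have inner (b : 'I_3) : (fun p => \sum_(c < 3)
      (Num.sqrt `|\det (metric a p)| * invmx (metric a p) b c)%:C
        * covariant e A c f p) =
    (fun p => (if b == 2 then E2 p / a else - a)%:C * covariant e A b f p).
  apply/funext => p; rewrite (bigD1 b)//= big1 ?addr0; last first.
    move=> c cb; rewrite invmx_metric !mxE [b == c]eq_sym (negbTE cb).
    by rewrite mulr0n mulr0 rmorph0 mul0r.
  rewrite sqrt_det_metric invmx_metric !mxE eqxx mulr1n; congr (_%:C * _).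
  have a0 : a != 0 by rewrite gt_eqF.
  have E0 : E2 p != 0 by rewrite gt_eqF// expR_gt0.
  by case: ifP => _; field.
by rewrite !inner.
Qed.

Lemma covariant_mul (A : 'rV[R]_3 -> 'rV[R]_3) (b : 'I_3)
    (k F : 'rV[R]_3 -> R[i]) q (dk dF : R[i]) :
    is_cderive q (delta_mx 0 b) k dk -> is_cderive q (delta_mx 0 b) F dF ->
  covariant e A b (fun p => k p * F p) q =
  dk * F q + k q * covariant e A b F q.
Proof.
move=> hk hF; rewrite /covariant /partial.
by rewrite (is_cderiveE (is_cderive_mul hk hF)) (is_cderiveE hF); ring.
Qed.

(** These are the q^1- and q^2-derivatives of the phase; D_1 and D_2 multiply phi_J by i times
    them. *)
Definition kappa1 q l : R := e * dS1 a mu1 mu2 q - dT1 a J l.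
Definition kappa2 q l : R := e * dS2 a mu1 mu2 q - dT2 a J l.

Lemma is_cderive_phiJ_slice Phi q u l : smooth Phi ->
  is_cderive q u (fun p => phiJ Phi (p, l))
    (phiJ (cderive (1 : R) Phi) (q, l) * (x3 u)%:C
     + 'i * (kappa1 q l * x1 u + kappa2 q l * x2 u
             + e * dS3 a mu1 mu2 q * x3 u)%:C * phiJ Phi (q, l)).
Proof.
move=> Ps; apply: is_cderive_slice_l.
apply: is_cderive_eq; first exact: is_cderive_phiJ.
rewrite !phiJE /dphase /kappa1 /kappa2 /= subr0 mulr0 subr0.
by ring.
Qed.

Lemma covariant0_phiJ Phi q l : smooth Phi ->
  cov 0 (fun p => phiJ Phi (p, l)) q = 'i * (kappa1 q l)%:C * phiJ Phi (q, l).
Proof.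
move=> Ps; rewrite /covariant /partial.
rewrite (is_cderiveE (is_cderive_phiJ_slice _ _ _ Ps)).
by rewrite /potential /x1 /x2 /x3 !mxE /=; ring.
Qed.

Lemma covariant1_phiJ Phi q l : smooth Phi ->
  cov 1 (fun p => phiJ Phi (p, l)) q = 'i * (kappa2 q l)%:C * phiJ Phi (q, l).
Proof.
move=> Ps; rewrite /covariant /partial.
rewrite (is_cderiveE (is_cderive_phiJ_slice _ _ _ Ps)).
by rewrite /potential /x1 /x2 /x3 !mxE /=; ring.
Qed.

(** The potential cancels the term i e dS/dq^3 produced by the exponential, and T does not depend on
    q^3. *)
Lemma covariant2_phiJ Phi q l : smooth Phi ->
  cov 2 (fun p => phiJ Phi (p, l)) q = phiJ (cderive (1 : R) Phi) (q, l).
Proof.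
move=> Ps; rewrite /covariant /partial.
rewrite (is_cderiveE (is_cderive_phiJ_slice _ _ _ Ps)).
by rewrite -/(dS3 a mu1 mu2 q) /x1 /x2 /x3 !mxE /=; ring.
Qed.

Lemma is_derive_x3 q (b : 'I_3) :
  is_derive q (delta_mx 0 b) (@x3 R) (x3 (delta_mx 0 b)).
Proof. by apply: is_derive_linear => h; rewrite /x3 !mxE. Qed.

(** Applied to [kappa1] and [kappa2], which depend on q through q^3 alone: the second D_1 or D_2
    then just multiplies by the same factor again. *)
Lemma is_cderive_imaginary_invariant (k : 'rV[R]_3 -> R) q (b : 'I_3) :
    (forall h p, k (h *: delta_mx 0 b + p) = k p) ->
  is_cderive q (delta_mx 0 b) (fun p => (- a)%:C * ('i * (k p)%:C)) 0.
Proof.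
move=> kE; apply: is_cderive_eq.
  apply: is_cderive_mul; first exact: is_cderive_cst.
  apply: is_cderive_mul; first exact: is_cderive_cst.
  apply: is_cderive_real; apply/is_derive_line0.
  under eq_fun do rewrite kE.
  exact: is_derive_constf.
by rewrite /=; ring.
Qed.

(** After division by a e^(2 a q^3), the first two directions give kappa^2 e^(-2 a q^3), since -a (i
    kappa)^2 = a kappa^2, and the third gives a^(-2) (Phi'' + 2 a Phi'). *)
Lemma klein_gordon_phiJ Phi q l : smooth Phi ->
  klein_gordon (metric a) (potential a mu1 mu2) e m zeta
    (fun p => phiJ Phi (p, l)) q =
  (a ^- 2)%:C * cis (phase a e mu1 mu2 J (q, l)) *
  (cderive (1 : R) (cderive (1 : R) Phi) (x3 q - l)
   + (2 * a)%:C * cderive (1 : R) Phi (x3 q - l)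
   + (a ^+ 2 * ((kappa1 q l ^+ 2 + kappa2 q l ^+ 2) / E2 q
                + 6 * zeta + m ^+ 2))%:C * Phi (x3 q - l)).
Proof.
move=> Ps; rewrite klein_gordon_metric.
have Ps' := smooth_cderive (1 : R) Ps.
under [X in covariant _ _ 0 X]eq_fun do rewrite covariant0_phiJ// mulrA.
under [X in covariant _ _ 1 X]eq_fun do rewrite covariant1_phiJ// mulrA.
under [X in covariant _ _ 2 X]eq_fun do rewrite covariant2_phiJ//.
have x3E (b : 'I_3) h p : b != 2 -> x3 (h *: delta_mx 0 b + p) = x3 p.
  by move=> /negbTE b2; rewrite /x3 !mxE eq_sym b2 mulr0 add0r.
rewrite (covariant_mul _ (is_cderive_imaginary_invariant _ _)
  (is_cderive_phiJ_slice _ _ _ Ps)); last first.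
  by move=> h p; rewrite /kappa1 /dS1 x3E.
rewrite (covariant_mul _ (is_cderive_imaginary_invariant _ _)
  (is_cderive_phiJ_slice _ _ _ Ps)); last first.
  by move=> h p; rewrite /kappa2 /dS2 x3E.
(* The derivative of the third weight is the source of the damping term 2 a Phi'. *)
have dE : is_derive q (delta_mx 0 2) (fun p => E2 p / a) (2 * E2 q).
  apply: (is_derive_eq (is_derive_mulf (is_derive_comp1 (is_derive_expR _)
    (is_derive_mulf (is_derive_constf _ _ _) (is_derive_x3 _ _)))
    (is_derive_constf _ _ _))).
  by rewrite /x3 !mxE /=; field; rewrite gt_eqF.
rewrite (covariant_mul _ (is_cderive_real dE) (is_cderive_phiJ_slice _ _ _ Ps')).
rewrite covariant0_phiJ// covariant1_phiJ// covariant2_phiJ// !phiJE /=.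
have a0 : a != 0 by rewrite gt_eqF.
have E0 : E2 q != 0 by rewrite gt_eqF// expR_gt0.
(* Comparing real and imaginary parts leaves rational identities over the reals. *)
move: (cis _) (kappa1 q l) (kappa2 q l) (E2 q) E0 => z k1 k2 E E0.
move: (cderive _ _ _) (cderive _ _ _) (Phi _) => [r2 i2] [r1 i1] [r0 i0].
by case: z => [zr zi]; apply: complex_ext => /=; field; rewrite a0 E0.
Qed.

(** The squares of the S- and T-terms lose their angles by cos^2 + sin^2 = 1, and the cross terms
    combine through the formulas for the cosine and sine of q^3 - l. *)
Lemma kappa_sqr q l :
  (kappa1 q l ^+ 2 + kappa2 q l ^+ 2) / E2 q =
  - (2 * e * J * expR (- (a * (x3 q - l))) / (1 + a ^+ 2))
    * ((a * mu1 - mu2) * cos (x3 q - l) + (mu1 + a * mu2) * sin (x3 q - l))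
  + J ^+ 2 * expR (- (2 * a * (x3 q - l)))
  + e ^+ 2 * (mu1 ^+ 2 + mu2 ^+ 2) / (1 + a ^+ 2).
Proof.
have aa := sqr_add1_neq0 a.
rewrite /kappa1 /kappa2 /dS1 /dS2 /dT1 /dT2.
have -> : - (a * (x3 q - l)) = a * l - a * x3 q by ring.
have -> : - (2 * a * (x3 q - l)) = (a * l - a * x3 q) + (a * l - a * x3 q) by ring.
have -> : 2 * a * x3 q = a * x3 q + a * x3 q by ring.
rewrite !expRD !expRN cosB sinB.
have E0 : expR (a * x3 q) != 0 by rewrite gt_eqF// expR_gt0.
have cs := cos2Dsin2 (x3 q); have cl := cos2Dsin2 l.
move: (expR (a * x3 q)) E0 (expR (a * l)) => E E0 L.
move: (cos (x3 q)) (sin (x3 q)) (cos l) (sin l) cs cl => c s c' s' cs cl.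
set al := a * mu1 - mu2; set be := mu1 + a * mu2.
have ab : al ^+ 2 + be ^+ 2 = (1 + a ^+ 2) * (mu1 ^+ 2 + mu2 ^+ 2).
  by rewrite /al /be; ring.
(* The intermediate form displays the factors cos^2 + sin^2 and alpha^2 + beta^2, so that the
   expansion is purely algebraic and the relations [cs], [cl] and [ab] enter only afterwards. *)
transitivity (e ^+ 2 / (1 + a ^+ 2) ^+ 2 * (al ^+ 2 + be ^+ 2) * (c ^+ 2 + s ^+ 2)
  - 2 * e * J * (L / E) / (1 + a ^+ 2)
    * (al * (c * c' + s * s') + be * (s * c' - c * s'))
  + J ^+ 2 * (L / E * (L / E)) * (c' ^+ 2 + s' ^+ 2)).
  by field; rewrite aa E0.
by rewrite cs cl ab; field; rewrite aa E0.
Qed.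

Lemma klein_gordon_reduced Phi : smooth Phi ->
  (forall q l, klein_gordon (metric a) (potential a mu1 mu2) e m zeta
     (fun p => phiJ Phi (p, l)) q = 0)
  <-> reduced_equation a e m zeta mu1 mu2 J Phi.
Proof.
move=> Ps.
have coefE q l : a ^+ 2 * ((kappa1 q l ^+ 2 + kappa2 q l ^+ 2) / E2 q
    + 6 * zeta + m ^+ 2) =
  - (2 * e * a ^+ 2 * J * expR (- (a * (x3 q - l))) / (1 + a ^+ 2))
     * ((a * mu1 - mu2) * cos (x3 q - l) + (mu1 + a * mu2) * sin (x3 q - l))
   + a ^+ 2 * J ^+ 2 * expR (- (2 * a * (x3 q - l)))
   + a ^+ 2 * (m ^+ 2 + 6 * zeta)
   + e ^+ 2 * a ^+ 2 * (mu1 ^+ 2 + mu2 ^+ 2) / (1 + a ^+ 2).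
  by rewrite kappa_sqr; field; exact: sqr_add1_neq0.
split=> [KG v|red q l]; last first.
  by rewrite klein_gordon_phiJ// coefE red mulr0.
(* Every v is reached as q^3 - l at q = (0, 0, v), l = 0. *)
have := KG (v *: delta_mx 0 2) 0.
rewrite klein_gordon_phiJ// coefE.
have -> : x3 (v *: delta_mx 0 2 : 'rV[R]_3) - 0 = v.
  by rewrite /x3 !mxE /= mulr1 subr0.
(* The prefactor a^(-2) exp(i theta) does not vanish, so the bracket does. *)
move=> /eqP; rewrite mulf_eq0 mulf_eq0 (negbTE (cis_neq0 _)) orbF.
case/orP => /eqP //.
move=> /(congr1 (@complex.Re R)) /= /eqP.
by rewrite invr_eq0 expf_eq0 /= gt_eqF.
Qed.

End KleinGordon.

Theorem mainTheorem7 (R : realType) (a e m zeta mu1 mu2 J : R)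
    (a_gt0 : 0 < a) (e_neq0 : e != 0) :
  (forall phi : 'rV[R]_3 * R -> R[i],
      (smooth phi /\ reduction_system a e mu1 mu2 J phi)
      <-> (exists Phi : R -> R[i],
             smooth Phi /\ forall x, phi x = phiJ a e mu1 mu2 J Phi x))
  /\
  (forall Phi : R -> R[i],
      smooth Phi ->
      ((forall (q : 'rV[R]_3) (l : R),
          klein_gordon (metric a) (potential a mu1 mu2) e m zeta
            (fun p => phiJ a e mu1 mu2 J Phi (p, l)) q = 0)
       <-> reduced_equation a e m zeta mu1 mu2 J Phi)).
Proof.
split=> [phi|Phi Ps]; last exact: klein_gordon_reduced.
split=> [[ps sys]|[Phi [Ps phiE]]]; last first.
  have -> : phi = phiJ a e mu1 mu2 J Phi by exact/funext.
  by split; [exact: smooth_phiJ|exact: phiJ_reduction_system].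
(* The amplitude is phi along the line q^1 = q^2 = l = 0; it is smooth as the composite of phi with
   a continuous linear embedding. *)
exists (fun v => phi (v *: delta_mx 0 2, 0)); split; last first.
  exact: reduction_system_phiJ.
apply: (smooth_comp_linear
  (M := fun v : R => (v *: delta_mx 0 2, 0) : 'rV[R]_3 * R)) => // [h x y|v].
  by congr pair; rewrite /= ?scalerDl ?scalerA ?scaler0 ?addr0.
have cM : {for v, continuous (fun v : R => v *: (delta_mx 0 2 : 'rV[R]_3))}%classic.
  exact: scalel_continuous.
have c0 : {for v, continuous (fun=> 0 : R)}%classic by exact: cvg_cst.
exact: (cvg_pair cM c0).
Qed.
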